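(* Let $\mathcal{B}$ be a set and let $H,H'\subseteq 2^{\mathcal{B}}$ be downward-closed compsets. Then their composition is $$H\times H'=\bigcup_{M\in\overline{H},\ M'\in\overline{H'}}2^{M\cap M'}=\langle M\cap M'\rangle_{M\in\overline{H},\ M'\in\overline{H'}}.$$ Therefore, if $H$ is $k$-conic and $H'$ is $k'$-conic, then $H\times H'$ is at most $kk'$-conic, i.e. it is $m$-conic for some $m\le kk'$.
   Context: Components are subsets of a fixed set $\mathcal{B}$ of behaviors, ordered by inclusion, with composition given by intersection. A compset is a set of components $H\subseteq 2^{\mathcal{B}}$; it is downward-closed if $M'\subseteq M\in H$ implies $M'\in H$. $\overline{H}=\{M\in H : \forall M'\in H,\ M\subseteq M'\Rightarrow M'=M\}$ is the set of maximal components of $H$. A downward-closed compset $H$ is called $k$-conic if $\overline{H}$ is finite of cardinality $k$. Here $2^M$ is the set of all subsets of $M$, and $\langle M_i\rangle_{i}$ denotes the downward-closed compset $\bigcup_i 2^{M_i}$. Composition of compsets is $H\times H'=\{M\cap M' : M\in H,\ M'\in H'\}$.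
   Formalization: It is additionally assumed that every component of H (resp. H') is contained in a maximal component of H (resp. H'); without this the claim fails, e.g. for H = H' = all finite subsets of the natural numbers, which has no maximal component. *)

(* Defs.v *)
From mathcomp Require Import all_boot.
From mathcomp Require Import boolp classical_sets functions cardinality.

Set Implicit Arguments.
Unset Strict Implicit.
Unset Printing Implicit Defensive.

Local Open Scope classical_set_scope.
Local Open Scope card_scope.

(* A component over the set of behaviors B is a term of type [set B]; a compset
   is a term of type [set (set B)]. *)

(* 2^M; the name powerset is taken by finset, for sets over a finType. *)
Definition cone {B : Type} (M : set B) : set (set B) :=
  [set M' | M' `<=` M].

Definition downward_closed {B : Type} (H : set (set B)) : Prop :=
  forall M M' : set B, M' `<=` M -> H M -> H M'.

Definition maximal_components {B : Type} (H : set (set B)) : set (set B) :=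
  [set M | H M /\ forall M', H M' -> M `<=` M' -> M' = M].

Definition conic {B : Type} (k : nat) (H : set (set B)) : Prop :=
  downward_closed H /\ maximal_components H #= `I_k.

Definition generated {B I : Type} (D : set I) (F : I -> set B) : set (set B) :=
  \bigcup_(i in D) cone (F i).

Definition compset_comp {B : Type} (H H' : set (set B)) : set (set B) :=
  [set M `&` M' | M in H & M' in H'].

(* Automatic when H is finite (e.g. B finite), but not in general: the compset
   of all finite subsets of an infinite B is downward-closed and has no maximal
   component.  Without this property a downward-closed compset need not be the
   union of the cones [cone M] over its maximal components M. *)
Definition has_enough_maximal {B : Type} (H : set (set B)) : Prop :=
  forall M, H M -> exists2 N, maximal_components H N & M `<=` N.

(* Main.v *)
Require Import Defs.
From mathcomp Require Import all_boot.
From mathcomp Require Import boolp classical_sets functions cardinality.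

Local Open Scope classical_set_scope.

(** Enlarging [M] and [M'] to maximal components [N] and [N'] places [M] ∩ [M'] below [N] ∩ [N'];
    conversely, by downward closure, any [L] below [N] ∩ [N'] lies in both compsets and equals [L] ∩
    [L]. So the intersections [N] ∩ [N'] generate the composition ([compset_comp_generated]). A
    maximal component of a generated compset is one of its generators
    ([maximal_components_generated]), and the generators are indexed by pairs, of which there are at
    most [k * k'] ([card_le_setX_II]). *)

(** A pair is coded by the number with quotient [f x] and remainder [g y] modulo [n]; division with
    remainder recovers both. *)
Lemma card_le_setX_II (T U : Type) (A : set T) (B : set U) (m n : nat) :
  (A #<= `I_m)%card -> (B #<= `I_n)%card -> (A `*` B #<= `I_(m * n))%card.
Proof.
move=> /pcard_leP[f] /pcard_leP[g].
have fm x : A x -> f x < m by move=> Ax; exact: (@funS _ _ _ _ f x Ax).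
have gn y : B y -> g y < n by move=> By; exact: (@funS _ _ _ _ g y By).
pose h (p : T * U) := f p.1 * n + g p.2.
have h_inj : {in A `*` B &, injective h}.
  move=> [x y] [x' y'] /set_mem[/= Ax By] /set_mem[/= Ax' By'] hE.
  (* Division by [n] is meaningful because [B] is inhabited by [y]. *)
  have n_gt0 : 0 < n by apply: leq_ltn_trans (gn _ By).
  have fE : f x = f x'.
    have := congr1 (divn^~ n) hE.
    by rewrite /= !divnMDl // !divn_small ?gn // !addn0.
  have gE : g y = g y'.
    have := congr1 (modn^~ n) hE.
    by rewrite /= !modnMDl !modn_small ?gn.
  by congr (_, _); [apply: (@inj _ _ A f) | apply: (@inj _ _ B g)];
     rewrite ?inE.
rewrite -(card_le_eql (inj_card_eq h_inj)); apply: subset_card_le.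
move=> _ [[x y] [/= Ax By] <-].
apply: (@leq_trans ((f x).+1 * n)); last by rewrite leq_mul2r fm ?orbT.
by rewrite /h /= mulSn addnC ltn_add2r gn.
Qed.

Lemma downward_closed_generated (B I : Type) (D : set I) (F : I -> set B) :
  downward_closed (generated D F).
Proof. by move=> M M' sM'M [i Di sMF]; exists i => //; apply: subset_trans sMF. Qed.

(** A maximal [M] lies below some [F i], which itself belongs to the compset, so maximality forces
    [F i = M]. *)
Lemma maximal_components_generated (B I : Type) (D : set I) (F : I -> set B) :
  maximal_components (generated D F) `<=` F @` D.
Proof. by move=> M [[i Di sMF] maxM]; exists i => //; apply: maxM => //; exists i. Qed.

Lemma compset_comp_generated (B : Type) (H H' : set (set B)) :
  downward_closed H -> downward_closed H' ->
  has_enough_maximal H -> has_enough_maximal H' ->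
  compset_comp H H' =
    generated (maximal_components H `*` maximal_components H')
              (fun p => p.1 `&` p.2).
Proof.
move=> dH dH' mH mH'; apply/seteqP; split => [_ [M HM [M' HM' <-]]|L].
  have [N maxN sMN] := mH _ HM; have [N' maxN' sMN'] := mH' _ HM'.
  by exists (N, N') => //; apply: setISS.
case=> -[N N'] /= [[HN _] [HN' _]]; rewrite /cone /= subsetI => -[sLN sLN'].
exists L; first exact: dH HN.
by exists L; [exact: dH' HN' | exact: setIid].
Qed.

Theorem mainTheorem10 (B : Type) (H H' : set (set B))
    (dH : downward_closed H) (dH' : downward_closed H')
    (mH : has_enough_maximal H) (mH' : has_enough_maximal H') :
  [/\ compset_comp H H' =
        \bigcup_(M in maximal_components H)
          \bigcup_(M' in maximal_components H') cone (M `&` M'),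
      compset_comp H H' =
        generated (maximal_components H `*` maximal_components H')
                  (fun p => p.1 `&` p.2) &
      forall k k' : nat, conic k H -> conic k' H' ->
        exists2 m : nat, (m <= k * k')%N & conic m (compset_comp H H')].
Proof.
have HE := compset_comp_generated B H H' dH dH' mH mH'.
rewrite HE; split=> // [|k k' [_ Hk] [_ Hk']].
  apply/seteqP; split => [L [[M M'] [maxM maxM'] sL]|L [M maxM [M' maxM' sL]]].
    by exists M => //; exists M'.
  by exists (M, M').
set G := generated _ _.
(* This is only a bound: distinct pairs may have equal intersections, or one intersection may
   strictly contain another. *)
have GN : (maximal_components G #<= `I_(k * k'))%card.
  apply: card_le_trans (subset_card_le (maximal_components_generated _ _ _ _)) _.
  apply: card_le_trans (card_image_le _ _) _.
  by apply: card_le_setX_II; [have /card_eqPle[] := Hk | have /card_eqPle[] := Hk'].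
(* Finiteness supplies the exact number [m] of maximal components; comparing initial segments of the
   naturals then bounds it. *)
have [m Gm] := card_le_finite GN (finite_II _).
exists m; first by rewrite -card_le_II -(card_le_eql Gm).
by split=> //; exact: downward_closed_generated.
Qed.
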